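(* The dimensional-splitting scheme described in the context (row sweeps (R1)--(R7), column sweeps (C1)--(C7), and the update (U)) ensures that the total mass is conserved during the evolution, i.e., for every solution of the scheme and every $n\in\{0,\dots,N-1\}$, $$m^{n+1}:=\sum_{i=1}^{N_x}\sum_{j=1}^{N_y}\phi_{i,j}^{n+1}=\sum_{i=1}^{N_x}\sum_{j=1}^{N_y}\phi_{i,j}^{n}=\cdots=\sum_{i=1}^{N_x}\sum_{j=1}^{N_y}\phi_{i,j}^{0}.$$
   Context: Parameters: real numbers $0<\varepsilon\ll1$ (interface width), $\kappa>0$ (contact line mobility), time step $\Delta t>0$, spatial steps $\Delta x>0$, $\Delta y>0$, prescribed contact angle $\theta_s\in[0,\pi]$, and positive integers $N_x,N_y,N$. A rectangular domain is divided into cells indexed by $i=1,\dots,N_x$, $j=1,\dots,N_y$; the row $j=1$ is adjacent to the substrate $\Gamma_w$. $\phi_{i,j}^n$ denotes the (approximate) cell average of the phase variable at time $n\Delta t$. Potential: $F$ is one of the following. (Logarithmic Flory--Huggins) $F(\chi)=F_{log}(\chi)-F_{log}(\beta)$ with $F_{log}(\chi)=\frac{\theta}{2}[(1+\chi)\ln(1+\chi)+(1-\chi)\ln(1-\chi)]+\frac12(1-\chi^2)$, $0<\theta<1$, where $\beta\in(0,1)$ is the positive root of $F_{log}'(\chi)=\frac{\theta}{2}\ln\frac{1+\chi}{1-\chi}-\chi=0$; (Polynomial) $F(\chi)=\frac14(1-\chi^2)^2$, with $\beta=1$. Put $c_F=\int_{-\beta}^{\beta}\sqrt{2F(\chi)}\,d\chi$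 and $g(\chi)=\frac{\varepsilon c_F\cos\theta_s}{4\beta^3}(\chi^3-3\beta^2\chi)$. Notation: $\chi^+=\max\{\chi,0\}$, $\chi^-=\min\{\chi,0\}$, and the two-state upwind mobility is $M(\chi_1,\chi_2)=(1+\chi_1)^+(1-\chi_2)^+$. For an array $\psi$ with ghost values, $(\Delta\psi)_{i,j}=\frac{\psi_{i+1,j}-2\psi_{i,j}+\psi_{i-1,j}}{\Delta x^2}+\frac{\psi_{i,j+1}-2\psi_{i,j}+\psi_{i,j-1}}{\Delta y^2}$. Scheme: a solution consists of $\phi_{i,j}^n$ ($0\le n\le N$) together with, for each $n=0,\dots,N-1$, intermediate quantities satisfying the following. Step 1 (row sweeps). Set $\widetilde\phi_{i,j}^{n,0}=\phi_{i,j}^n$. For $q=1,\dots,N_y$ there are values $\widetilde\phi_{i,j}^{n,q},\widetilde\mu_{i,j}^{n,q}$, fluxes $\widetilde J^{n,q}$, velocities $\widetilde V^{n,q}$, scalars $\widetilde\xi^{n,q},\widetilde\eta^{n,q}$ and ghost values with: (R1) $\widetilde\phi_{i,j}^{n,q}-\widetilde\phi_{i,j}^{n,q-1}=-\frac{\Delta t}{\Delta x}(\widetilde J_{i+\frac12,j}^{n,q}-\widetilde J_{i-\frac12,j}^{n,q})$ if $j=q$, and $=0$ otherwise. (R2) $\widetilde J_{i+\frac12,j}^{n,q}=(\widetilde V_{i+\frac12,j}^{n,q})^+M(\widetilde\phi_{i,j}^{n,q},\widetilde\phi_{i+1,j}^{n,q})+(\widetilde V_{i+\frac12,j}^{n,q})^-M(\widetilde\phi_{i+1,j}^{n,q},\widetilde\phi_{i,j}^{n,q})$,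 with $\widetilde V_{i+\frac12,j}^{n,q}=-\frac1{\Delta x}(\widetilde\mu_{i+1,j}^{n,q}-\widetilde\mu_{i,j}^{n,q})$ (faces between two cells; boundary faces are covered by (R3)). (R3) No flux: $\widetilde J_{\frac12,j}^{n,q}=\widetilde J_{N_x+\frac12,j}^{n,q}=0$ for all $j$. (R4) $\widetilde\mu_{i,j}^{n,q}=-\varepsilon^2(\Delta\widetilde\phi)_{i,j}^{n,q}+\widetilde\xi^{n,q}F'(\widetilde\phi_{i,j}^{n,q})$. (R5) $\sum_{i,j}(F(\widetilde\phi_{i,j}^{n,q})-F(\widetilde\phi_{i,j}^{n,q-1}))=\widetilde\xi^{n,q}\sum_{i,j}F'(\widetilde\phi_{i,j}^{n,q})(\widetilde\phi_{i,j}^{n,q}-\widetilde\phi_{i,j}^{n,q-1})$ (sums over all cells). (R6) $\sum_{i=1}^{N_x}(g(\widetilde\phi_{i,1}^{n,q})-g(\widetilde\phi_{i,1}^{n,q-1}))=\widetilde\eta^{n,q}\sum_{i=1}^{N_x}g'(\widetilde\phi_{i,1}^{n,q})(\widetilde\phi_{i,1}^{n,q}-\widetilde\phi_{i,1}^{n,q-1})$. (R7) Ghost values: $\widetilde\phi_{0,j}^{n,q}=\widetilde\phi_{1,j}^{n,q}$, $\widetilde\phi_{N_x+1,j}^{n,q}=\widetilde\phi_{N_x,j}^{n,q}$, $\widetilde\phi_{i,N_y+1}^{n,q}=\widetilde\phi_{i,N_y}^{n,q}$, $\widetilde\phi_{i,0}^{n,q}=\widetilde\phi_{i,1}^{n,q}-\frac{\Delta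 y}{\varepsilon^2}\left(\frac{\widetilde\phi_{i,1}^{n,q}-\widetilde\phi_{i,1}^{n,q-1}}{\kappa\Delta t}+\widetilde\eta^{n,q}g'(\widetilde\phi_{i,1}^{n,q})\right)$. (These implement the dynamic contact line condition $\frac{\widetilde\phi_{i,1}^{n,q}-\widetilde\phi_{i,1}^{n,q-1}}{\kappa\Delta t}=\varepsilon^2\frac{\widetilde\phi_{i,1}^{n,q}-\widetilde\phi_{i,0}^{n,q}}{\Delta y}-\widetilde\eta^{n,q}g'(\widetilde\phi_{i,1}^{n,q})$ for $q=1$; for $q\ne1$ the left-hand side is $0$.) Step 2 (column sweeps). Set $\widehat\phi_{i,j}^{n,0}=\widetilde\phi_{i,j}^{n,N_y}$. For $p=1,\dots,N_x$ there are values $\widehat\phi_{i,j}^{n,p},\widehat\mu_{i,j}^{n,p}$, fluxes $\widehat J^{n,p}$, velocities $\widehat V^{n,p}$, scalars $\widehat\xi^{n,p},\widehat\eta^{n,p}$ and ghost values with: (C1) $\widehat\phi_{i,j}^{n,p}-\widehat\phi_{i,j}^{n,p-1}=-\frac{\Delta t}{\Delta y}(\widehat J_{i,j+\frac12}^{n,p}-\widehat J_{i,j-\frac12}^{n,p})$ if $i=p$, and $=0$ otherwise. (C2) $\widehat J_{i,j+\frac12}^{n,p}=(\widehat V_{i,j+\frac12}^{n,p})^+M(\widehat\phi_{i,j}^{n,p},\widehat\phi_{i,j+1}^{n,p})+(\widehat V_{i,j+\frac12}^{n,p})^-M(\widehat\phi_{i,j+1}^{n,p},\widehat\phi_{i,j}^{n,p})$,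 with $\widehat V_{i,j+\frac12}^{n,p}=-\frac1{\Delta y}(\widehat\mu_{i,j+1}^{n,p}-\widehat\mu_{i,j}^{n,p})$ (faces between two cells; boundary faces are covered by (C3)). (C3) No flux: $\widehat J_{i,\frac12}^{n,p}=\widehat J_{i,N_y+\frac12}^{n,p}=0$ for all $i$. (C4) $\widehat\mu_{i,j}^{n,p}=-\varepsilon^2(\Delta\widehat\phi)_{i,j}^{n,p}+\widehat\xi^{n,p}F'(\widehat\phi_{i,j}^{n,p})$. (C5) $\sum_{i,j}(F(\widehat\phi_{i,j}^{n,p})-F(\widehat\phi_{i,j}^{n,p-1}))=\widehat\xi^{n,p}\sum_{i,j}F'(\widehat\phi_{i,j}^{n,p})(\widehat\phi_{i,j}^{n,p}-\widehat\phi_{i,j}^{n,p-1})$ (sums over all cells). (C6) $\sum_{i=1}^{N_x}(g(\widehat\phi_{i,1}^{n,p})-g(\widehat\phi_{i,1}^{n,p-1}))=\widehat\eta^{n,p}\sum_{i=1}^{N_x}g'(\widehat\phi_{i,1}^{n,p})(\widehat\phi_{i,1}^{n,p}-\widehat\phi_{i,1}^{n,p-1})$. (C7) Ghost values: $\widehat\phi_{0,j}^{n,p}=\widehat\phi_{1,j}^{n,p}$, $\widehat\phi_{N_x+1,j}^{n,p}=\widehat\phi_{N_x,j}^{n,p}$, $\widehat\phi_{i,N_y+1}^{n,p}=\widehat\phi_{i,N_y}^{n,p}$, $\widehat\phi_{i,0}^{n,p}=\widehat\phi_{i,1}^{n,p}-\frac{\Delta y}{\varepsilon^2}\left(\frac{\widehat\phi_{i,1}^{n,p}-\widehat\phi_{i,1}^{n,p-1}}{\kappa\Delta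 t}+\widehat\eta^{n,p}g'(\widehat\phi_{i,1}^{n,p})\right)$. (These implement the dynamic contact line condition $\frac{\widehat\phi_{i,1}^{n,p}-\widehat\phi_{i,1}^{n,p-1}}{\kappa\Delta t}=\varepsilon^2\frac{\widehat\phi_{i,1}^{n,p}-\widehat\phi_{i,0}^{n,p}}{\Delta y}-\widehat\eta^{n,p}g'(\widehat\phi_{i,1}^{n,p})$ for $i=p$; for $i\ne p$ the left-hand side is $0$.) (U) $\phi_{i,j}^{n+1}=\widehat\phi_{i,j}^{n,N_x}$, and $\xi^{n+1}=\frac{\sum_{q=1}^{N_y}\widetilde\xi^{n,q}+\sum_{p=1}^{N_x}\widehat\xi^{n,p}}{N_y+N_x}$, $\eta^{n+1}=\frac{\sum_{q=1}^{N_y}\widetilde\eta^{n,q}+\sum_{p=1}^{N_x}\widehat\eta^{n,p}}{N_y+N_x}$. *)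

(* Defs.v *)
From HB Require Import structures.
From mathcomp Require Import all_boot all_order all_algebra.
From mathcomp Require Import all_classical all_reals all_analysis.

Set Implicit Arguments.
Unset Strict Implicit.
Unset Printing Implicit Defensive.

Import Order.TTheory GRing.Theory Num.Theory.
Import numFieldNormedType.Exports.

Local Open Scope ring_scope.

(** Free energy density.  The library's [ln] and [derive1] are total, so the
    logarithmic potential and its derivative have conventional values outside
    their natural domains; no range condition on the phase variable is imposed. *)

Definition Flog (R : realType) (theta chi : R) : R :=
  theta / 2 * ((1 + chi) * ln (1 + chi) + (1 - chi) * ln (1 - chi))
  + (1 - chi ^+ 2) / 2.

Inductive potential (R : realType) : Type :=
  | FloryHuggins (theta beta : R)
  | Polynomial.
Arguments Polynomial {R}.

Definition potential_ok (R : realType) (p : potential R) : Prop :=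
  match p with
  | FloryHuggins theta beta =>
      [/\ 0 < theta < 1, 0 < beta < 1 & derive1 (Flog theta) beta = 0]
  | Polynomial => True
  end.

Definition pot_beta (R : realType) (p : potential R) : R :=
  match p with
  | FloryHuggins _ beta => beta
  | Polynomial => 1
  end.

Definition pot_F (R : realType) (p : potential R) (chi : R) : R :=
  match p with
  | FloryHuggins theta beta => Flog theta chi - Flog theta beta
  | Polynomial => (1 - chi ^+ 2) ^+ 2 / 4
  end.

Definition pot_c (R : realType) (p : potential R) : R :=
  \int[lebesgue_measure]_(chi in `[- pot_beta p, pot_beta p]%classic)
    Num.sqrt (2 * pot_F p chi).

(** [Nt] is the number of time steps. *)
Record scheme_data (R : realType) := SchemeData {
  eps : R;
  kappa : R;
  dt : R;
  dx : R;
  dy : R;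
  theta_s : R;
  pot : potential R;
  Nx : nat;
  Ny : nat;
  Nt : nat }.

Definition wall_g (R : realType) (D : scheme_data R) (chi : R) : R :=
  let beta := pot_beta (pot D) in
  eps D * pot_c (pot D) * cos (theta_s D) / (4 * beta ^+ 3)
  * (chi ^+ 3 - 3 * beta ^+ 2 * chi).

Definition pos_part (R : realType) (x : R) : R := Num.max x 0.
Definition neg_part (R : realType) (x : R) : R := Num.min x 0.

Definition mobility (R : realType) (chi1 chi2 : R) : R :=
  pos_part (1 + chi1) * pos_part (1 - chi2).

Definition upwind_flux (R : realType) (V phiL phiR : R) : R :=
  pos_part V * mobility phiL phiR + neg_part V * mobility phiR phiL.

(** An array indexed by (i, j).  Cells are 1 <= i <= Nx, 1 <= j <= Ny; cell
    arrays carry their ghost values at i = 0, Nx + 1 and j = 0, Ny + 1.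
    Half-integer faces are indexed by their lower neighbour: entry (i, j) of a
    horizontal flux is the value at (i + 1/2, j), and entry (i, j) of a vertical
    flux is the value at (i, j + 1/2).  All other entries are irrelevant. *)
Definition grid (R : realType) := nat -> nat -> R.

Definition is_cell (R : realType) (D : scheme_data R) (i j : nat) : bool :=
  (1 <= i <= Nx D)%N && (1 <= j <= Ny D)%N.

Definition sum_cells (R : realType) (D : scheme_data R) (f : grid R) : R :=
  \sum_(1 <= i < (Nx D).+1) \sum_(1 <= j < (Ny D).+1) f i j.

Definition sum_wall (R : realType) (D : scheme_data R) (f : nat -> R) : R :=
  \sum_(1 <= i < (Nx D).+1) f i.

Definition laplacian (R : realType) (D : scheme_data R) (psi : grid R)
    (i j : nat) : R :=
  (psi i.+1 j - 2 * psi i j + psi i.-1 j) / dx D ^+ 2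
  + (psi i j.+1 - 2 * psi i j + psi i j.-1) / dy D ^+ 2.

Definition chemical_potential (R : realType) (D : scheme_data R)
    (phi mu : grid R) (xi : R) : Prop :=
  forall i j : nat, is_cell D i j ->
    mu i j = - eps D ^+ 2 * laplacian D phi i j
             + xi * derive1 (pot_F (pot D)) (phi i j).

Definition bulk_relation (R : realType) (D : scheme_data R)
    (phi0 phi : grid R) (xi : R) : Prop :=
  let F := pot_F (pot D) in
  sum_cells D (fun i j => F (phi i j) - F (phi0 i j)) =
  xi * sum_cells D (fun i j => derive1 F (phi i j) * (phi i j - phi0 i j)).

Definition wall_relation (R : realType) (D : scheme_data R)
    (phi0 phi : grid R) (eta : R) : Prop :=
  let g := wall_g D in
  sum_wall D (fun i => g (phi i 1%N) - g (phi0 i 1%N)) =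
  eta * sum_wall D (fun i => derive1 g (phi i 1%N) * (phi i 1%N - phi0 i 1%N)).

Definition ghost_values (R : realType) (D : scheme_data R)
    (phi0 phi : grid R) (eta : R) : Prop :=
  (forall j : nat, (1 <= j <= Ny D)%N ->
     phi 0%N j = phi 1%N j /\ phi (Nx D).+1 j = phi (Nx D) j) /\
  (forall i : nat, (1 <= i <= Nx D)%N ->
     phi i (Ny D).+1 = phi i (Ny D) /\
     phi i 0%N = phi i 1%N - dy D / eps D ^+ 2 *
       ((phi i 1%N - phi0 i 1%N) / (kappa D * dt D)
        + eta * derive1 (wall_g D) (phi i 1%N))).

(** One substep of the row sweep, updating row [q] of [phi0] to give [phi]. *)
Record row_substep (R : realType) (D : scheme_data R) (q : nat)
    (phi0 phi mu J V : grid R) (xi eta : R) : Prop := RowSubstep {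
  row_update : forall i j : nat, is_cell D i j ->
    phi i j - phi0 i j =
    if j == q then - (dt D / dx D) * (J i j - J i.-1 j) else 0;
  row_flux : forall i j : nat, (1 <= i < Nx D)%N -> (1 <= j <= Ny D)%N ->
    J i j = upwind_flux (V i j) (phi i j) (phi i.+1 j);
  row_velocity : forall i j : nat, (1 <= i < Nx D)%N -> (1 <= j <= Ny D)%N ->
    V i j = - (1 / dx D) * (mu i.+1 j - mu i j);
  row_noflux : forall j : nat, (1 <= j <= Ny D)%N ->
    J 0%N j = 0 /\ J (Nx D) j = 0;
  row_mu : chemical_potential D phi mu xi;
  row_bulk : bulk_relation D phi0 phi xi;
  row_wall : wall_relation D phi0 phi eta;
  row_ghost : ghost_values D phi0 phi eta }.

(** One substep of the column sweep, updating column [p] of [phi0]. *)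
Record col_substep (R : realType) (D : scheme_data R) (p : nat)
    (phi0 phi mu J V : grid R) (xi eta : R) : Prop := ColSubstep {
  col_update : forall i j : nat, is_cell D i j ->
    phi i j - phi0 i j =
    if i == p then - (dt D / dy D) * (J i j - J i j.-1) else 0;
  col_flux : forall i j : nat, (1 <= i <= Nx D)%N -> (1 <= j < Ny D)%N ->
    J i j = upwind_flux (V i j) (phi i j) (phi i j.+1);
  col_velocity : forall i j : nat, (1 <= i <= Nx D)%N -> (1 <= j < Ny D)%N ->
    V i j = - (1 / dy D) * (mu i j.+1 - mu i j);
  col_noflux : forall i : nat, (1 <= i <= Nx D)%N ->
    J i 0%N = 0 /\ J i (Ny D) = 0;
  col_mu : chemical_potential D phi mu xi;
  col_bulk : bulk_relation D phi0 phi xi;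
  col_wall : wall_relation D phi0 phi eta;
  col_ghost : ghost_values D phi0 phi eta }.

(** [tphi n q] and [hphi n p] are the intermediate row- and column-sweep values
    at time step [n] after substep [q], resp. [p]; the other families with
    prefixes [t] and [h] are indexed in the same way.  In [phi n] only the cell
    entries are meaningful. *)
Record scheme_solution (R : realType) (D : scheme_data R) := SchemeSolution {
  phi : nat -> grid R;
  xi : nat -> R;
  eta : nat -> R;
  tphi : nat -> nat -> grid R;
  tmu : nat -> nat -> grid R;
  tJ : nat -> nat -> grid R;
  tV : nat -> nat -> grid R;
  txi : nat -> nat -> R;
  teta : nat -> nat -> R;
  hphi : nat -> nat -> grid R;
  hmu : nat -> nat -> grid R;
  hJ : nat -> nat -> grid R;
  hV : nat -> nat -> grid R;
  hxi : nat -> nat -> R;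
  heta : nat -> nat -> R;
  row_start : forall n : nat, (n < Nt D)%N ->
    forall i j : nat, is_cell D i j -> tphi n 0%N i j = phi n i j;
  row_sweep : forall n : nat, (n < Nt D)%N ->
    forall q : nat, (1 <= q <= Ny D)%N ->
    row_substep D q (tphi n q.-1) (tphi n q) (tmu n q) (tJ n q) (tV n q)
      (txi n q) (teta n q);
  col_start : forall n : nat, (n < Nt D)%N ->
    forall i j : nat, is_cell D i j -> hphi n 0%N i j = tphi n (Ny D) i j;
  col_sweep : forall n : nat, (n < Nt D)%N ->
    forall p : nat, (1 <= p <= Nx D)%N ->
    col_substep D p (hphi n p.-1) (hphi n p) (hmu n p) (hJ n p) (hV n p)
      (hxi n p) (heta n p);
  update_phi : forall n : nat, (n < Nt D)%N ->
    forall i j : nat, is_cell D i j -> phi n.+1 i j = hphi n (Nx D) i j;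
  update_xi : forall n : nat, (n < Nt D)%N ->
    xi n.+1 = (\sum_(1 <= q < (Ny D).+1) txi n q
               + \sum_(1 <= p < (Nx D).+1) hxi n p) / (Ny D + Nx D)%:R;
  update_eta : forall n : nat, (n < Nt D)%N ->
    eta n.+1 = (\sum_(1 <= q < (Ny D).+1) teta n q
                + \sum_(1 <= p < (Nx D).+1) heta n p) / (Ny D + Nx D)%:R }.

Definition mass (R : realType) (D : scheme_data R) (S : scheme_solution D)
    (n : nat) : R := sum_cells D (phi S n).

(* Main.v *)
Require Import Defs.
From HB Require Import structures.
From mathcomp Require Import all_boot all_order all_algebra.
From mathcomp Require Import all_classical all_reals all_analysis.

Import Order.TTheory GRing.Theory Num.Theory.
Import numFieldNormedType.Exports.

Local Open Scope ring_scope.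

(** The scheme is in conservation form: a substep changes one line of cells, and
    changes it by a discrete divergence of a flux. Along that line the flux
    differences telescope to the difference of the two boundary fluxes, both of
    which vanish, so the line keeps its mass ([line_mass_conserved]). Every other
    line is left alone, so each substep conserves the total mass
    ([row_substep_mass], [col_substep_mass]). Composing the substeps of both
    sweeps gives conservation over a time step ([step_mass]), and composing time
    steps gives the theorem. *)

(** The boolean [b] says whether the line is the one that the substep updates;
    with it, updated and untouched lines are treated together. *)
Lemma line_mass_conserved (R : pzRingType) (m : nat) (b : bool) (c : R)
    (f0 f J : nat -> R) :
  (forall i : nat, (1 <= i <= m)%N ->
     f i - f0 i = if b then c * (J i - J i.-1) else 0) ->
  J 0%N = 0 -> J m = 0 ->
  \sum_(1 <= i < m.+1) f i = \sum_(1 <= i < m.+1) f0 i.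
Proof.
move=> f_upd J0 Jm; apply/eqP; rewrite -subr_eq0 -sumrB.
rewrite (@eq_big_nat _ _ _ 1 m.+1 _ _ f_upd); case: b {f_upd}; last by rewrite big1.
by rewrite -mulr_sumr big_add1 /= telescope_sumr // J0 Jm subrr mulr0.
Qed.

Lemma eq_sum_cells {R : realType} (D : scheme_data R) (f g : grid R) :
  (forall i j : nat, is_cell D i j -> f i j = g i j) ->
  sum_cells D f = sum_cells D g.
Proof.
move=> fg; apply: eq_big_nat => i i_in; apply: eq_big_nat => j j_in.
by apply: fg; apply/andP.
Qed.

(** The fluxes telescope in the first index, so the double sum has to be
    reordered to sum along rows first. *)
Lemma row_substep_mass {R : realType} (D : scheme_data R) (q : nat)
    (phi0 phi mu J V : grid R) (xi eta : R) :
  row_substep D q phi0 phi mu J V xi eta ->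
  sum_cells D phi = sum_cells D phi0.
Proof.
move=> sub; rewrite /sum_cells exchange_big [RHS]exchange_big /=.
apply: eq_big_nat => j j_in; have [J0 JN] := row_noflux sub j_in.
apply: (@line_mass_conserved _ _ (j == q) (- (dt D / dx D)) _ _ (J^~ j)) => //.
by move=> i i_in; apply: (row_update sub); apply/andP.
Qed.

Lemma col_substep_mass {R : realType} (D : scheme_data R) (p : nat)
    (phi0 phi mu J V : grid R) (xi eta : R) :
  col_substep D p phi0 phi mu J V xi eta ->
  sum_cells D phi = sum_cells D phi0.
Proof.
move=> sub; apply: eq_big_nat => i i_in; have [J0 JN] := col_noflux sub i_in.
apply: (@line_mass_conserved _ _ (i == p) (- (dt D / dy D)) _ _ (J i)) => //.
by move=> j j_in; apply: (col_update sub); apply/andP.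
Qed.

Lemma constant_sequence (T : Type) (u : nat -> T) (m : nat) :
  (forall k : nat, (1 <= k <= m)%N -> u k = u k.-1) -> u m = u 0%N.
Proof.
elim: m => // m IHm u_const; rewrite (u_const m.+1) ?leqnn //=.
by apply: IHm => k /andP[k_gt0 k_le]; rewrite u_const // k_gt0 leqW.
Qed.

Lemma step_mass {R : realType} (D : scheme_data R) (sol : scheme_solution D)
    (n : nat) :
  (n < Nt D)%N -> mass sol n.+1 = mass sol n.
Proof.
move=> n_lt; rewrite /mass (eq_sum_cells D _ _ (update_phi sol n_lt)).
rewrite (constant_sequence _ (fun p => sum_cells D (hphi sol n p))); last first.
  by move=> p p_in; apply: col_substep_mass (col_sweep sol n_lt p_in).
rewrite (eq_sum_cells D _ _ (col_start sol n_lt)).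
rewrite (constant_sequence _ (fun q => sum_cells D (tphi sol n q))); last first.
  by move=> q q_in; apply: row_substep_mass (row_sweep sol n_lt q_in).
exact: (eq_sum_cells D _ _ (row_start sol n_lt)).
Qed.

Theorem theorem5 (R : realType) (D : scheme_data R)
  (eps_bounds : 0 < eps D < 1) (kappa_gt0 : 0 < kappa D)
  (dt_gt0 : 0 < dt D) (dx_gt0 : 0 < dx D) (dy_gt0 : 0 < dy D)
  (theta_s_bounds : 0 <= theta_s D <= pi) (pot_valid : potential_ok (pot D))
  (Nx_gt0 : (0 < Nx D)%N) (Ny_gt0 : (0 < Ny D)%N) (Nt_gt0 : (0 < Nt D)%N)
  (sol : scheme_solution D) (n : nat) (n_lt : (n < Nt D)%N) :
  forall k : nat, (k <= n)%N -> mass sol n.+1 = mass sol k.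
Proof.
have mass0 m : (m <= Nt D)%N -> mass sol m = mass sol 0%N.
  move=> m_le; apply: (constant_sequence _ (mass sol)) => -[//|i] /= i_lt.
  exact: step_mass (leq_trans i_lt m_le).
move=> k k_le; rewrite mass0 // [RHS]mass0 //.
exact: leq_trans k_le (ltnW n_lt).
Qed.
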